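(* Let $A\in\mathbb{R}^{n\times n}$ be symmetric positive definite, let $b\in\mathbb{R}^n$ and $k\ge1$, and let $\mathcal{S}=\mathcal{K}_k(A,b):=\operatorname{span}\{b,Ab,\dots,A^{k-1}b\}$, assumed to have dimension at least $1$. Let $\omega_{\min}:=-\lambda_{\min}(A)<0$. For $\omega\in(\omega_{\min},\infty)$ let $x_{b,\omega}:=\operatorname*{arg\,min}_{x\in\mathcal{S}}\|(A+\omega I)^{-1/2}(b-Ax)\|_2$, and let $x_{b,\infty}:=\operatorname*{arg\,min}_{x\in\mathcal{S}}\|b-Ax\|_2$. Then for all $\omega\in(0,\infty)$, $x_{b,\omega}$ is a convex combination of $x_{b,0}$ and $x_{b,\infty}$. Moreover, if $\mathrm{Ind}_A(\mathcal{S})=1$, then $\dim(\mathcal{X}_b)=1$, where $\mathcal{X}_b$ is the affine hull of $\{x_{b,\omega}:\omega>\omega_{\min}\}$.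
   Context: $\mathrm{Ind}_A(\mathcal{S}):=\dim(\mathcal{S}+A\mathcal{S})-\dim(\mathcal{S})$. $\lambda_{\min}(A)$ is the smallest eigenvalue of $A$. For $\omega>\omega_{\min}$, $A+\omega I$ is symmetric positive definite, its power $-1/2$ is defined via the spectral decomposition, and all the minimizers above exist and are unique. *)

(* Defs.v *)
From HB Require Import structures.
From mathcomp Require Import all_boot all_order all_algebra.
From mathcomp Require Import boolp classical_sets reals exp.
Set Implicit Arguments.
Unset Strict Implicit.
Unset Printing Implicit Defensive.

Import Order.TTheory GRing.Theory Num.Theory.
Local Open Scope classical_set_scope.
Local Open Scope ring_scope.

(* The norm that MathComp-Analysis puts on matrices is the max norm. *)
Definition norm2 (R : realType) (n : nat) (v : 'cV[R]_n) : R :=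
  Num.sqrt (\sum_i v i 0 ^+ 2).

Definition spd (R : realType) (n : nat) (A : 'M[R]_n) : Prop :=
  A \is symmetricmx /\
  forall x : 'cV[R]_n, x != 0 -> 0 < (x^T *m A *m x) 0 0.

Definition lambda_min (R : realType) (n : nat) (A : 'M[R]_n) : R :=
  xget 0 [set l | eigenvalue A l /\ forall m, eigenvalue A m -> l <= m].

Definition omega_min (R : realType) (n : nat) (A : 'M[R]_n) : R :=
  - lambda_min A.

(* [B] is the [a]-th power of [M]: the eigenvalues in some spectral
   decomposition of [M] are raised to the power [a].  Meaningful for [M]
   symmetric positive definite; [B] then does not depend on the chosen
   decomposition. *)
Definition is_mxpow (R : realType) (n : nat) (M : 'M[R]_n) (a : R)
    (B : 'M[R]_n) : Prop :=
  exists (Q : 'M[R]_n) (d : 'rV[R]_n),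
    [/\ Q^T *m Q = 1%:M,
        M = Q *m diag_mx d *m Q^T &
        B = Q *m diag_mx (map_mx (fun l => l `^ a) d) *m Q^T].

Definition mxpow (R : realType) (n : nat) (M : 'M[R]_n) (a : R) : 'M[R]_n :=
  xget 0 [set B | is_mxpow M a B].

Definition argmin (R : realType) (n : nat) (S : {vspace 'cV[R]_n})
    (f : 'cV[R]_n -> R) : 'cV[R]_n :=
  xget 0 [set x | x \in S /\ forall y, y \in S -> f x <= f y].

Definition krylov (R : realType) (n : nat) (k : nat) (A : 'M[R]_n)
    (b : 'cV[R]_n) : {vspace 'cV[R]_n} :=
  <<[seq A ^+ i *m b | i <- iota 0 k]>>%VS.

(* The truncated subtraction is harmless: [S] is a subspace of [S + A S]. *)
Definition Ind (R : realType) (n : nat) (A : 'M[R]_n)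
    (S : {vspace 'cV[R]_n}) : nat :=
  (\dim (S + linfun (mulmx A) @: S) - \dim S)%N.

Definition x_omega (R : realType) (n : nat) (A : 'M[R]_n) (b : 'cV[R]_n)
    (S : {vspace 'cV[R]_n}) (w : R) : 'cV[R]_n :=
  argmin S (fun x => norm2 (mxpow (A + w%:M) (- 2^-1) *m (b - A *m x))).

Definition x_infty (R : realType) (n : nat) (A : 'M[R]_n) (b : 'cV[R]_n)
    (S : {vspace 'cV[R]_n}) : 'cV[R]_n :=
  argmin S (fun x => norm2 (b - A *m x)).

Definition convex_combination (R : realType) (V : lmodType R) (x y z : V)
    : Prop :=
  exists2 t : R, 0 <= t <= 1 & z = t *: x + (1 - t) *: y.

Definition affine_hull (R : realType) (V : lmodType R) (X : set V) : set V :=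
  [set y | exists (m : nat) (x : 'I_m -> V) (c : 'I_m -> R),
     [/\ forall i, X (x i), \sum_i c i = 1 & y = \sum_i c i *: x i]].

(* [X] is an affine subspace whose direction has dimension [d]. *)
Definition has_affine_dim (R : realType) (V : vectType R) (X : set V)
    (d : nat) : Prop :=
  exists (p : V) (D : {vspace V}),
    X = [set p + v | v in [set v | v \in D]] /\ \dim D = d.

(* Main.v *)
(* Put [r_w = b - A x_w] and [u = (A + w I)^-1 r_w].  The normal equations say
   that [u] is orthogonal to [A S], that [r_0] is orthogonal to [S] and that
   [r_oo] is orthogonal to [A S].  For a Krylov space, [S + A S] is both
   [A S + <b>] and [S + <A^k b>], so unless [r_oo = 0] there are [t], [tau] with
   [e := w u - t r_oo] and [f := A u - tau r_0] orthogonal to [S + A S].  As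
   [e + f = r_w - tau r_0 - t r_oo] lies in [S + A S], it vanishes, which gives
   [tau = 1 - t] and [x_w = (1 - t) x_0 + t x_oo].  Pairing these relations,
     [t |r_oo|^2 = w <u, (A + w I) u>],
     [t (1 - t) |r_oo|^2 = w <u, A u> + |e|^2],
   so [0 <= t <= 1] when [w > 0].  If [Ind_A(S) = 1] then [r_oo <> 0], hence
   [x_0 <> x_oo] and [t > 0] for [w = 1]: the points [x_w] span a line. *)
Require Import Defs.
From HB Require Import structures.
From mathcomp Require Import all_boot all_order all_algebra.
From mathcomp Require Import complex ring lra.
From mathcomp Require Import boolp classical_sets reals exp.
Set Implicit Arguments.
Unset Strict Implicit.
Unset Printing Implicit Defensive.
Import Order.TTheory GRing.Theory Num.Theory.
Local Open Scope classical_set_scope.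
Local Open Scope ring_scope.

(** * The Euclidean inner product on column vectors *)

Definition dot (R : realType) (n : nat) (u v : 'cV[R]_n) : R := (u^T *m v) 0 0.

Lemma dotE (R : realType) n (u v : 'cV[R]_n) : dot u v = \sum_i u i 0 * v i 0.
Proof. by rewrite /dot mxE; apply: eq_bigr => i _; rewrite mxE. Qed.

Lemma dotC (R : realType) n (u v : 'cV[R]_n) : dot u v = dot v u.
Proof. by rewrite !dotE; apply: eq_bigr => i _; rewrite mulrC. Qed.

Lemma dotDl (R : realType) n (u v w : 'cV[R]_n) :
  dot (u + v) w = dot u w + dot v w.
Proof. by rewrite /dot linearD mulmxDl mxE. Qed.

Lemma dotZl (R : realType) n a (u v : 'cV[R]_n) : dot (a *: u) v = a * dot u v.
Proof. by rewrite /dot linearZ -scalemxAl mxE. Qed.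

Lemma dotNl (R : realType) n (u v : 'cV[R]_n) : dot (- u) v = - dot u v.
Proof. by rewrite -scaleN1r dotZl mulN1r. Qed.

Lemma dotBl (R : realType) n (u v w : 'cV[R]_n) :
  dot (u - v) w = dot u w - dot v w.
Proof. by rewrite dotDl dotNl. Qed.

Lemma dotDr (R : realType) n (u v w : 'cV[R]_n) :
  dot w (u + v) = dot w u + dot w v.
Proof. by rewrite !(dotC w) dotDl. Qed.

Lemma dotZr (R : realType) n a (u v : 'cV[R]_n) : dot v (a *: u) = a * dot v u.
Proof. by rewrite !(dotC v) dotZl. Qed.

Lemma dotBr (R : realType) n (u v w : 'cV[R]_n) :
  dot w (u - v) = dot w u - dot w v.
Proof. by rewrite !(dotC w) dotBl. Qed.

Lemma dot0l (R : realType) n (u : 'cV[R]_n) : dot 0 u = 0.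
Proof. by rewrite -(scale0r u) dotZl mul0r. Qed.

Lemma dot0r (R : realType) n (u : 'cV[R]_n) : dot u 0 = 0.
Proof. by rewrite dotC dot0l. Qed.

Lemma dot_mull (R : realType) m n (K : 'M[R]_(m, n)) (u : 'cV_n) (v : 'cV_m) :
  dot (K *m u) v = dot u (K^T *m v).
Proof. by rewrite /dot trmx_mul mulmxA. Qed.

Lemma dot_ge0 (R : realType) n (u : 'cV[R]_n) : 0 <= dot u u.
Proof. by rewrite dotE sumr_ge0 // => i _; rewrite -expr2 sqr_ge0. Qed.

Lemma dot_eq0 (R : realType) n (u : 'cV[R]_n) : (dot u u == 0) = (u == 0).
Proof.
apply/eqP/eqP => [|->]; last by rewrite dot0l.
rewrite dotE => /psumr_eq0P u0; apply/colP => i; rewrite mxE; apply/eqP.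
rewrite -[_ == 0]orbb -mulf_eq0; apply/eqP; apply: u0 => // j _.
by rewrite -expr2 sqr_ge0.
Qed.

Lemma dot_gt0 (R : realType) n (u : 'cV[R]_n) : u != 0 -> 0 < dot u u.
Proof. by rewrite lt_def dot_ge0 dot_eq0 => ->. Qed.

(** * The spectral theorem for real symmetric matrices *)

Lemma symmetricmx_trmx (R : realType) n (A : 'M[R]_n) :
  A \is symmetricmx <-> A^T = A.
Proof.
split=> [/is_hermitianmxP|AT].
  by rewrite expr0 scale1r map_mx_id // => /esym.
by apply/is_hermitianmxP; rewrite expr0 scale1r map_mx_id.
Qed.

(** Over the complex numbers [A] is Hermitian, so its spectral diagonal is real; an eigenvalue lying
    in [R] already has an eigenvector over [R], which is then normalised. *)
Lemma sym_unit_eigenvector (R : realType) n (A : 'M[R]_n) : (0 < n)%N ->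
  A^T = A -> exists a v, dot v v = 1 /\ A *m v = a *: v.
Proof.
move=> n_gt0 AT; pose AC := map_mx (real_complex R) A.
have ACh : AC \is hermsymmx.
  apply: realsym_hermsym.
    by apply/is_hermitianmxP; rewrite expr0 scale1r map_mx_id // map_trmx AT.
  by apply/mxOverP => i j; rewrite mxE; apply/complex_realP; exists (A i j).
have dR := hermitian_spectral_diag_real ACh.
have /orthomx_spectralP ACE := hermitian_normalmx ACh.
pose i0 := Ordinal n_gt0.
have /complex_realP[a da] := mxOverP dR 0 i0.
(* The rows of the diagonalising matrix are left eigenvectors. *)
have : eigenvalue AC (real_complex R a).
  apply/eigenvalueP; exists (row i0 (spectralmx AC)).
    rewrite {2}ACE !mulmxA -row_mul mulmxV ?spectral_unit // row1 -rowE.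
    rewrite -row_mul mul_diag_mx; apply/rowP=> j; rewrite !mxE.
    by rewrite da.
  apply/negP => /eqP r0; have := spectral_unit AC.
  rewrite -row_free_unit => /row_freeP[B /(congr1 (row i0))].
  rewrite row_mul r0 mul0mx row1 => /rowP/(_ i0)/eqP.
  by rewrite !mxE !eqxx eq_sym oner_eq0.
rewrite eigenvalue_map => /eigenvalueP[v vA v0]; exists a.
have vn0 : 0 < dot v^T v^T.
  by apply: dot_gt0; rewrite -(inj_eq (@trmx_inj _ _ _)) trmxK trmx0.
exists ((Num.sqrt (dot v^T v^T))^-1 *: v^T); split.
  rewrite dotZl dotZr mulrA -expr2 exprVn sqr_sqrtr ?ltW // mulVf //.
  exact: lt0r_neq0.
by rewrite -scalemxAr -AT -trmx_mul vA linearZ /= scalerA mulrC -scalerA.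
Qed.

(* The Householder reflection exchanging [e_0] and [v]; when [v = e_0] the
   division by zero makes it the identity. *)
Lemma householder (R : realType) n (v : 'cV[R]_(1 + n)) : dot v v = 1 ->
  exists H : 'M[R]_(1 + n),
    [/\ H^T = H, H *m H = 1%:M & H *m delta_mx 0 0 = v].
Proof.
move=> v1; pose e : 'cV[R]_(1 + n) := delta_mx 0 0; pose w := e - v.
have mulww (u : 'cV_(1 + n)) : w *m w^T *m u = dot w u *: w.
  by rewrite -mulmxA [w^T *m u]mx11_scalar mul_mx_scalar.
have e1 : dot e e = 1.
  rewrite dotE (bigD1 0) //= big1 ?addr0; first by rewrite !mxE mulr1.
  by move=> i /negPf i0; rewrite !mxE i0 mul0r.
pose c := 2 / dot w w; exists (1%:M - c *: (w *m w^T)); split.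
- by rewrite linearB /= trmx1 linearZ /= trmx_mul trmxK.
- have -> : (1%:M - c *: (w *m w^T)) *m (1%:M - c *: (w *m w^T)) =
            1%:M - (2 * c - c * c * dot w w) *: (w *m w^T).
    rewrite mulmxBl mul1mx mulmxBr mulmx1 -scalemxAl -scalemxAr mulmxA mulww.
    by rewrite -scalemxAl; apply/matrixP=> i j; rewrite !mxE; ring.
  have [w0|w0] := eqVneq (dot w w) 0.
    by rewrite /c w0 invr0 !mulr0 subr0 scale0r subr0.
  have -> : 2 * c - c * c * dot w w = 0 by rewrite /c; field.
  by rewrite scale0r subr0.
- rewrite mulmxBl mul1mx -scalemxAl mulww scalerA -/e.
  have [w0|w0] := eqVneq (dot w w) 0.
    move/eqP: w0; rewrite dot_eq0 => /eqP w0; rewrite w0 scaler0 subr0.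
    by apply/eqP; rewrite -subr_eq0 -/w w0.
  have we : dot w w = 2 * dot w e.
    by rewrite [in LHS]/w dotBr /w !dotBl e1 v1 (dotC e v); ring.
  have -> : c * dot w e = 1.
    move: w0; rewrite /c we mulf_eq0 negb_or => /andP[_ w0].
    by field; rewrite w0.
  by rewrite scale1r /w subKr.
Qed.

(** Deflation: conjugating by the reflection that sends the first basis vector to a unit eigenvector
    makes that basis vector an eigenvector; symmetry then splits off a 1 by 1 block, and induction
    handles the rest. *)
Theorem real_spectral (R : realType) n (A : 'M[R]_n) : A^T = A ->
  exists (Q : 'M[R]_n) (d : 'rV[R]_n),
    Q^T *m Q = 1%:M /\ A = Q *m diag_mx d *m Q^T.
Proof.
elim: n A => [|n IHn] A AT.
  by exists 1%:M, 0; split; apply/matrixP => -[].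
rewrite -[n.+1]/(1 + n)%N in A AT *.
have [a [v [v1 Av]]] := sym_unit_eigenvector (ltn0Sn n : 0 < 1 + n)%N AT.
have [H [HT HH He]] := householder v1.
have [B defB] : exists B : 'M[R]_(1 + n), B = H *m A *m H
  by exists (H *m A *m H).
have BT : B^T = B by rewrite defB !trmx_mul HT AT mulmxA.
have Be : B *m delta_mx 0 0 = a *: delta_mx 0 0 :> 'cV_(1 + n).
  by rewrite defB -mulmxA He -mulmxA Av -scalemxAr -He mulmxA HH mul1mx.
have Bi0 i : B i 0 = a * (i == 0)%:R.
  have /colP/(_ i) := Be; rewrite -colE !mxE => ->.
  by rewrite eqxx andbT.
have BdT : (drsubmx B)^T = drsubmx B by rewrite trmx_drsub BT.
have [Q [d [QQ BdE]]] := IHn _ BdT.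
have BE : B = block_mx a%:M 0 0 (drsubmx B).
  have l0 : dlsubmx B = 0.
    by apply/matrixP=> i j; rewrite !mxE ord1 lshift0 Bi0 mulr0.
  rewrite -[LHS]submxK l0 -[ursubmx B]trmxK trmx_ursub BT l0 trmx0.
  congr block_mx; apply/matrixP=> i j.
  by rewrite !ord1 !mxE !lshift0 Bi0 eqxx mulr1.
pose P : 'M[R]_(1 + n) := block_mx 1%:M 0 0 Q.
exists (H *m P), (row_mx a%:M d); split.
  rewrite trmx_mul HT mulmxA -(mulmxA _ H H) HH mulmx1 /P tr_block_mx.
  rewrite mulmx_block !trmx0 trmx1 !(mulmx0, mul0mx, mulmx1, addr0, add0r) QQ.
  by rewrite -scalar_mx_block.
rewrite trmx_mul HT.
have -> : A = H *m B *m H.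
  by rewrite defB !mulmxA HH mul1mx -mulmxA HH mulmx1.
rewrite -!mulmxA; congr (_ *m _); rewrite !mulmxA; congr (_ *m _).
rewrite BE {1}BdE diag_mx_row /P tr_block_mx !mulmx_block !trmx0 trmx1.
rewrite !(mulmx0, mul0mx, mulmx1, mul1mx, addr0, add0r).
by congr block_mx; apply/matrixP=> i j; rewrite !ord1 !mxE.
Qed.

(** * Positive definite matrices: inverse square root, least eigenvalue, shifts *)

Lemma spd_sym (R : realType) n (A : 'M[R]_n) : spd A -> A^T = A.
Proof. by case=> /symmetricmx_trmx. Qed.

Lemma spd_gt0 (R : realType) n (A : 'M[R]_n) (x : 'cV[R]_n) :
  spd A -> x != 0 -> 0 < dot x (A *m x).
Proof. by case=> _ pA /pA; rewrite /dot mulmxA. Qed.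

Lemma spd_ge0 (R : realType) n (A : 'M[R]_n) (x : 'cV[R]_n) :
  spd A -> 0 <= dot x (A *m x).
Proof.
move=> sA; have [->|x0] := eqVneq x 0; first by rewrite dot0l.
exact/ltW/spd_gt0.
Qed.

Lemma spd_eq0 (R : realType) n (A : 'M[R]_n) (x : 'cV[R]_n) :
  spd A -> dot x (A *m x) = 0 -> x = 0.
Proof.
move=> sA xAx; apply/eqP; apply: contra_eqT xAx => /(spd_gt0 sA).
by rewrite lt_def => /andP[].
Qed.

Lemma mulmx_diag_tr_mx (R : realType) n (Q : 'M[R]_n) (d : 'rV[R]_n) i :
  Q^T *m Q = 1%:M -> Q *m diag_mx d *m Q^T *m col i Q = d 0 i *: col i Q.
Proof.
move=> QQ; rewrite colE !mulmxA -(mulmxA _ Q^T Q) QQ mulmx1 -mulmxA.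
rewrite mul_diag_mx scalemxAr; congr (_ *m _); apply/colP=> j; rewrite !mxE.
by have [->|] := eqVneq j i; rewrite ?mulr0.
Qed.

Lemma col_orthogonal (R : realType) n (Q : 'M[R]_n) i :
  Q^T *m Q = 1%:M -> dot (col i Q) (col i Q) = 1.
Proof.
move=> /matrixP/(_ i i); rewrite !mxE eqxx mulr1n => <-; rewrite dotE.
by apply: eq_bigr => j _; rewrite !mxE.
Qed.

(** Whichever decomposition [mxpow] picks, its eigenvalues are positive and their inverse square
    roots square to inverses. The power enters the normal equations only through this Gram
    matrix. *)
Lemma spd_mxpow_inv_sqrt (R : realType) n (M : 'M[R]_n) : spd M ->
  M *m ((mxpow M (- 2^-1))^T *m mxpow M (- 2^-1)) = 1%:M.
Proof.
move=> sM; have [Q0 [d0 [QQ0 ME0]]] := real_spectral (spd_sym sM).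
(* The spectral theorem provides a candidate, so [xget] does not return its default. *)
have [Q [d [QQ ME ->]]] : is_mxpow M (- 2^-1) (mxpow M (- 2^-1)).
  apply: (@xgetPex _ 0 [set B | is_mxpow M (- 2^-1) B]).
  by eexists; exists Q0, d0.
have d_gt0 i : 0 < d 0 i.
  have ci : col i Q != 0.
    by rewrite -dot_eq0 (col_orthogonal i QQ) oner_eq0.
  have := spd_gt0 sM ci; rewrite {1}ME mulmx_diag_tr_mx // dotZr.
  by rewrite (col_orthogonal i QQ) mulr1.
rewrite !trmx_mul trmxK tr_diag_mx {1}ME !mulmxA.
rewrite -(mulmxA _ Q^T Q) QQ mulmx1 -(mulmxA _ Q^T Q) QQ mulmx1.
rewrite -2!(mulmxA Q) !mulmx_diag (_ : diag_mx _ = 1%:M) ?mulmx1.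
  exact: mulmx1C.
rewrite -diag_const_mx; congr diag_mx; apply/rowP=> i; rewrite !mxE.
rewrite powRN powR12_sqrt ?(ltW (d_gt0 i)) // -mulrA -expr2 exprVn.
by rewrite sqr_sqrtr ?ltW ?divff ?gt_eqF.
Qed.

(** [eigenvalue] speaks of row vectors; symmetry allows transposing. *)
Lemma eigenvalue_sym (R : realType) n (A : 'M[R]_n) l : A^T = A ->
  eigenvalue A l <-> exists2 v : 'cV_n, v != 0 & A *m v = l *: v.
Proof.
move=> AT; split=> [/eigenvalueP[v vA v0]|[v v0 Av]].
  exists v^T; first by rewrite -(inj_eq (@trmx_inj _ _ _)) trmxK trmx0.
  by rewrite -AT -trmx_mul vA linearZ.
apply/eigenvalueP; exists v^T.
  by rewrite -AT -trmx_mul Av linearZ.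
by rewrite -(inj_eq (@trmx_inj _ _ _)) trmxK trmx0.
Qed.

Lemma lambda_minP (R : realType) n (A : 'M[R]_n) : (0 < n)%N -> A^T = A ->
  eigenvalue A (lambda_min A) /\
  forall m, eigenvalue A m -> lambda_min A <= m.
Proof.
move=> n_gt0 AT.
suff [l lP] : [set l | eigenvalue A l /\ forall m, eigenvalue A m -> l <= m]
    !=set0.
  by apply: (@xgetPex _ 0 [set l | eigenvalue A l /\
    forall m, eigenvalue A m -> l <= m]); exists l.
have [Q [d [QQ AE]]] := real_spectral AT.
case: (@arg_minP _ _ _ (Ordinal n_gt0) xpredT (d 0) isT) => i _ di.
exists (d 0 i); split.
  apply/(eigenvalue_sym _ AT); exists (col i Q).
    by rewrite -dot_eq0 (col_orthogonal i QQ) oner_eq0.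
  by rewrite {1}AE mulmx_diag_tr_mx.
move=> m /(eigenvalue_sym _ AT)[v v0 Av].
have Qv0 : Q^T *m v != 0.
  apply: contra_neq v0 => /(congr1 (mulmx Q)).
  by rewrite mulmxA (mulmx1C QQ) mul1mx mulmx0.
have {}Av : diag_mx d *m (Q^T *m v) = m *: (Q^T *m v).
  by rewrite scalemxAr -Av AE !mulmxA QQ mul1mx.
(* A nonzero coordinate in the basis [Q] forces [m] to be a diagonal entry. *)
have [j vj] : exists j, (Q^T *m v) j 0 != 0.
  apply/existsP; apply: contra_neqT Qv0; rewrite negb_exists => /forallP v0'.
  by apply/colP=> j; rewrite [RHS]mxE; apply/eqP; rewrite -[_ == _]negbK.
suff -> : m = d 0 j by exact: di.
move/colP/(_ j): Av; rewrite mul_diag_mx [LHS]mxE [RHS]mxE => /(mulIf vj).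
by [].
Qed.

Lemma omega_min_lt0 (R : realType) n (A : 'M[R]_n) : (0 < n)%N -> spd A ->
  omega_min A < 0.
Proof.
move=> n_gt0 sA; have AT := spd_sym sA.
have [/(eigenvalue_sym _ AT)[v v0 Av] _] := lambda_minP n_gt0 AT.
have := spd_gt0 sA v0; rewrite Av dotZr pmulr_lgt0 ?dot_gt0 //.
by rewrite /omega_min oppr_lt0.
Qed.

(** In an eigenbasis the quadratic form is the sum of the [(d_i + w) y_i^2], where
    [d_i + w >= lambda_min A + w > 0]. *)
Lemma spd_shift (R : realType) n (A : 'M[R]_n) w : (0 < n)%N -> spd A ->
  omega_min A < w -> spd (A + w%:M).
Proof.
move=> n_gt0 sA ww; have AT := spd_sym sA.
have [_ lmin] := lambda_minP n_gt0 AT.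
have [Q [d [QQ AE]]] := real_spectral AT.
have dw i : 0 < d 0 i + w.
  suff /lmin : eigenvalue A (d 0 i) by move: ww; rewrite /omega_min; lra.
  apply/(eigenvalue_sym _ AT); exists (col i Q).
    by rewrite -dot_eq0 (col_orthogonal i QQ) oner_eq0.
  by rewrite {1}AE mulmx_diag_tr_mx.
split.
  by apply/symmetricmx_trmx; rewrite linearD /= AT tr_scalar_mx.
move=> x x0; rewrite -mulmxA -/(dot _ _).
have Qx0 : Q^T *m x != 0.
  apply: contra_neq x0 => /(congr1 (mulmx Q)).
  by rewrite mulmxA (mulmx1C QQ) mul1mx mulmx0.
have -> : A + w%:M = Q *m diag_mx (d + const_mx w) *m Q^T.
  rewrite linearD /= mulmxDr mulmxDl -AE diag_const_mx mul_mx_scalar.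
  by rewrite -scalemxAl (mulmx1C QQ) scalemx1.
rewrite -!mulmxA -{1}[Q]trmxK -dot_mull dotE.
have yDy (y : 'cV_n) i : y i 0 * (diag_mx (d + const_mx w) *m y) i 0 =
    (d 0 i + w) * y i 0 ^+ 2.
  by rewrite mul_diag_mx !mxE; ring.
have ge0 i : true -> 0 <= (d 0 i + w) * (Q^T *m x) i 0 ^+ 2.
  by move=> _; rewrite mulr_ge0 ?sqr_ge0 ?ltW.
under eq_bigr do rewrite yDy.
rewrite lt_def sumr_ge0 // andbT.
apply: contra_neqT Qx0 => /negPn/eqP/(psumr_eq0P ge0) h.
apply/colP=> i; rewrite [RHS]mxE; apply/eqP.
by have /eqP := h i isT; rewrite mulf_eq0 gt_eqF //= sqrf_eq0.
Qed.

(** * Least squares and normal equations *)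

(** Gram-Schmidt along a spanning list: the new vector [v] is corrected by [p] so that
    [K *m (v - p)] is orthogonal to the image of the earlier span, and [q] is then adjusted along
    [v - p]. *)
Lemma least_squares_exists (R : realType) n (K : 'M[R]_n)
    (S : {vspace 'cV[R]_n}) (z : 'cV[R]_n) :
  exists2 x, x \in S & forall y, y \in S -> dot (K *m y) (z - K *m x) = 0.
Proof.
rewrite -(span_basis (vbasisP S)); elim: (tval _) z => [|v X IHX] z.
  exists 0 => [|y]; rewrite span_nil ?mem0v // memv0 => /eqP ->.
  by rewrite mulmx0 dot0l.
have [p pX pP] := IHX (K *m v); have [q qX qP] := IHX z.
pose v' := v - p; pose a := dot (K *m v') (z - K *m q) / dot (K *m v') (K *m v').
have v'P y : y \in <<X>>%VS -> dot (K *m y) (K *m v') = 0.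
  by move=> yX; rewrite mulmxBr pP.
have resE : z - K *m (q + a *: v') = z - K *m q - a *: (K *m v').
  by rewrite mulmxDr -scalemxAr opprD addrA.
exists (q + a *: v') => [|y].
  rewrite span_cons addrC /a /v' scalerBr -addrA memv_add //.
    by rewrite memvZ // memv_line.
  by rewrite addrC memvB // memvZ.
rewrite span_cons => /memv_addP[_ /vlineP[c ->] [s sX ->]].
have -> : c *: v + s = c *: v' + (c *: p + s).
  by rewrite addrA -scalerDr subrK.
have sX' : c *: p + s \in <<X>>%VS by rewrite memvD // memvZ.
rewrite mulmxDr dotDl -scalemxAr dotZl resE !dotBr !dotZr v'P // mulr0 subr0.
rewrite -[X in _ + X]dotBr (qP _ sX') addr0 -dotBr /a.
(* If [K *m v'] is zero, [a] is a division by zero, but both products vanish. *)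
have [v0|v0] := eqVneq (dot (K *m v') (K *m v')) 0.
  move/eqP: (v0); rewrite dot_eq0 => /eqP ->.
  by rewrite dot0l mul0r mul0r subr0 mulr0.
by rewrite divfK // subrr mulr0.
Qed.

Lemma norm2E (R : realType) n (v : 'cV[R]_n) : norm2 v = Num.sqrt (dot v v).
Proof. by rewrite /norm2 dotE; under eq_bigr do rewrite expr2. Qed.

(** By Pythagoras the least squares solution [p] is a minimizer, so one exists. [K] may be singular
    and [x] may differ from [p], but minimality still forces [K *m x = K *m p]. *)
Lemma argmin_norm2P (R : realType) n (K : 'M[R]_n) (S : {vspace 'cV[R]_n})
    (z : 'cV[R]_n) (x := argmin S (fun x => norm2 (z - K *m x))) :
  x \in S /\ forall y, y \in S -> dot (K *m y) (z - K *m x) = 0.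
Proof.
have [p pS pP] := least_squares_exists K S z.
have pythagoras y : y \in S -> dot (z - K *m y) (z - K *m y) =
    dot (z - K *m p) (z - K *m p) + dot (K *m (p - y)) (K *m (p - y)).
  move=> yS; have := pP (p - y) (memvB pS yS).
  have -> : z - K *m y = z - K *m p + K *m (p - y).
    by rewrite mulmxBr addrA subrK.
  move: (z - K *m p) (K *m (p - y)) => r s rs.
  by rewrite !(dotDl, dotDr) (dotC r s) rs; ring.
have : [set x | x \in S /\ forall y, y \in S ->
    norm2 (z - K *m x) <= norm2 (z - K *m y)] x.
  apply: (@xgetPex _ 0); exists p; split=> // y yS.
  by rewrite !norm2E ler_sqrt ?dot_ge0 // (pythagoras y) // lerDl dot_ge0.
move=> [xS xmin]; split=> // y yS.
have := xmin p pS; rewrite !norm2E ler_sqrt ?dot_ge0 // (pythagoras x) // gerDl.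
move=> Kpx0; have : dot (K *m (p - x)) (K *m (p - x)) == 0.
  by rewrite eq_le Kpx0 dot_ge0.
rewrite dot_eq0 mulmxBr subr_eq0 => /eqP <-; exact: pP.
Qed.

(** * Krylov spaces under multiplication by [A] *)

Lemma memv_krylov_gen (R : realType) n k (A : 'M[R]_n) (b : 'cV[R]_n) :
  (1 <= k)%N -> b \in krylov k A b.
Proof.
case: k => // k _; rewrite /krylov /= expr0 span_cons.
by rewrite -[X in X \in _]mul1mx (subvP (addvSl _ _)) ?memv_line.
Qed.

(** Each generator other than [b] is [A] times the preceding one. *)
Lemma krylov_decomp (R : realType) n k (A : 'M[R]_n) (b y : 'cV[R]_n) :
  y \in krylov k A b -> exists c z, z \in krylov k A b /\ y = c *: b + A *m z.
Proof.
set S := krylov k A b => yS.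
have : y \in (<[b]> + linfun (mulmx A) @: S)%VS.
  move: yS; apply/subvP/span_subvP => _ /mapP[[|i] ik ->].
    rewrite expr0 -[_ *m b]/(1%:M *m b) mul1mx.
    by rewrite (subvP (addvSl _ _)) ?memv_line.
  apply: (subvP (addvSr _ _)).
  have -> : A ^+ i.+1 *m b = linfun (mulmx A) (A ^+ i *m b).
    by rewrite lfunE /= mulmxA exprS.
  apply: memv_img; apply: memv_span; apply/mapP; exists i => //.
  by move: ik; rewrite !mem_iota /= add0n; apply: ltnW.
move=> /memv_addP[_ /vlineP[c ->] [_ /memv_imgP[z zS ->] ->]].
by exists c, z; rewrite lfunE.
Qed.

(** [A] shifts each generator to the next; only the last one can leave the space, towards
    [A ^+ k *m b]. *)
Lemma krylov_img (R : realType) n k (A : 'M[R]_n) (b y : 'cV[R]_n) :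
  y \in krylov k A b ->
  exists s c, s \in krylov k A b /\ A *m y = s + c *: (A ^+ k *m b).
Proof.
set S := krylov k A b => yS.
have : linfun (mulmx A) y \in (S + <[A ^+ k *m b]>)%VS.
  apply: (subvP _ _ (memv_img (linfun (mulmx A)) yS)).
  rewrite limg_span; apply/span_subvP => _ /mapP[_ /mapP[i ik ->] ->].
  rewrite lfunE /= mulmxA -[A *m _]/(A * _) -exprS.
  move: ik; rewrite mem_iota add0n => /andP[_ ik].
  have [ik1|] := ltnP i.+1 k.
    apply: (subvP (addvSl _ _)); apply/memv_span/mapP; exists i.+1 => //.
    by rewrite mem_iota.
  move=> ki; have -> : i.+1 = k by apply/eqP; rewrite eqn_leq ik ki.
  by rewrite (subvP (addvSr _ _)) ?memv_line.
move=> /memv_addP[s sS [_ /vlineP[c ->]]]; rewrite lfunE /= => ->.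
by exists s, c.
Qed.

(** * The position of [x_w] on the line through [x_0] and [x_oo] *)

(** The residual is then [A *m (z - x)], an element of [A S] orthogonal to [A S]. *)
Lemma residual_eq0_of_mem_img (R : realType) n (A : 'M[R]_n)
    (S : {vspace 'cV[R]_n}) (b x z : 'cV[R]_n) :
  x \in S -> (forall y, y \in S -> dot (A *m y) (b - A *m x) = 0) ->
  z \in S -> b = A *m z -> b - A *m x = 0.
Proof.
move=> xS xP zS bz; apply/eqP; rewrite -dot_eq0 {1}bz -mulmxBr.
by rewrite xP // memvB.
Qed.

(** The Krylov structure enters as two inclusions, with [g] standing for [A ^+ k *m b], and the
    minimizers enter through their normal equations. The final inequality is the second pairing with
    the term [|e|^2] dropped. *)
Lemma residual_interpolation (R : realType) n (A : 'M[R]_n)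
    (S : {vspace 'cV[R]_n}) (b g x0 xi x u : 'cV[R]_n) (w : R) :
  spd A -> b \in S ->
  (forall y, y \in S -> exists c z, z \in S /\ y = c *: b + A *m z) ->
  (forall y, y \in S -> exists s c, s \in S /\ A *m y = s + c *: g) ->
  x0 \in S -> (forall y, y \in S -> dot y (b - A *m x0) = 0) ->
  xi \in S -> (forall y, y \in S -> dot (A *m y) (b - A *m xi) = 0) ->
  x \in S -> (forall y, y \in S -> dot (A *m y) u = 0) ->
  A *m u + w *: u = b - A *m x ->
  b - A *m xi != 0 ->
  exists t, [/\ x = (1 - t) *: x0 + t *: xi,
    t * dot (b - A *m xi) (b - A *m xi) = w * dot u (A *m u + w *: u) &
    w * dot u (A *m u) <= t * (1 - t) * dot (b - A *m xi) (b - A *m xi)].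
Proof.
move=> sA bS decS imgS x0S x0P xiS xiP xS uP uE ri0.
have AT := spd_sym sA.
have bAS z : z \in S -> b <> A *m z.
  move=> zS bz; case/eqP: ri0.
  exact: (residual_eq0_of_mem_img xiS xiP zS).
set ri := b - A *m xi in xiP ri0 *; set r0 := b - A *m x0 in x0P.
have r0n : dot r0 r0 != 0.
  rewrite dot_eq0 subr_eq0; apply/eqP; exact: bAS.
have rin : dot ri ri != 0 by rewrite dot_eq0.
(* [t] and [tau] are projection coefficients, making [e] orthogonal to [ri] and [f] to [r0]. *)
pose t := dot (w *: u) ri / dot ri ri; pose e := w *: u - t *: ri.
pose tau := dot (A *m u) r0 / dot r0 r0; pose f := A *m u - tau *: r0.
have eAS y : y \in S -> dot e (A *m y) = 0.
  by move=> yS; rewrite dotC dotBr !dotZr uP // xiP // !mulr0 subr0.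
have eri : dot e ri = 0 by rewrite dotBl (dotZl t) divfK // subrr.
have eb : dot e b = 0.
  by rewrite -(subrK (A *m xi) b) dotDr eAS // addr0 eri.
have eS y : y \in S -> dot e y = 0.
  by move=> /decS[c [z [zS ->]]]; rewrite dotDr dotZr eb mulr0 eAS // addr0.
have fS y : y \in S -> dot f y = 0.
  move=> yS; rewrite dotC dotBr dotZr x0P // mulr0 subr0.
  by rewrite -{1}AT -dot_mull uP.
have fr0 : dot f r0 = 0 by rewrite dotBl dotZl divfK // subrr.
(* [r0] is an element of [S] minus [c *: g]. If [c] were 0, [r0] would lie in [S] and be orthogonal
   to itself; so orthogonality to [r0] and [S] passes to [g]. *)
have fg : dot f g = 0.
  have [s [c [sS Ax0]]] := imgS _ x0S.
  have r0E : r0 = (b - s) - c *: g by rewrite /r0 Ax0 opprD addrA.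
  have c0 : c != 0.
    apply: contraNneq r0n => c0; rewrite {1}r0E c0 scale0r subr0.
    by rewrite x0P // memvB.
  move: fr0; rewrite r0E dotBr dotZr fS ?memvB // sub0r => /eqP.
  by rewrite oppr_eq0 mulf_eq0 (negPf c0) => /eqP.
have fAS y : y \in S -> dot f (A *m y) = 0.
  move=> /imgS[s [c [sS ->]]].
  by rewrite dotDr dotZr fg fS // mulr0 addr0.
have efE : e + f = (1 - tau - t) *: b - A *m (x - tau *: x0 - t *: xi).
  have -> : e + f = (A *m u + w *: u) - tau *: r0 - t *: ri.
    by rewrite /e /f; apply/colP=> i; rewrite !mxE; ring.
  rewrite uE /r0 /ri !mulmxBr -!scalemxAr; apply/colP=> i.
  by rewrite !mxE; ring.
have zS : x - tau *: x0 - t *: xi \in S by rewrite !memvB // memvZ.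
have ef : e + f = 0.
  apply/eqP; rewrite -dot_eq0 {2}efE dotDl !dotBr !dotZr eb (fS _ bS).
  by rewrite (eAS _ zS) (fAS _ zS) mulr0 subrr addr0.
(* Otherwise [e + f = 0] could be solved for [b], putting [b] in [A S]. *)
have tauE : tau = 1 - t.
  apply/eqP; rewrite eq_sym -subr_eq0 -addrAC; apply/negPn/negP => h.
  apply: (bAS ((1 - tau - t)^-1 *: (x - tau *: x0 - t *: xi))).
    by rewrite memvZ.
  move/eqP: ef; rewrite efE subr_eq0 => /eqP bE.
  by rewrite -scalemxAr -bE scalerA mulVf ?scale1r // addrAC.
have dur : dot u ri = dot u (A *m u + w *: u).
  rewrite uE /ri !dotBr (dotC u (A *m xi)) (dotC u (A *m x)).
  by rewrite !uP // !subr0.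
exists t; split.
- move/eqP: ef; rewrite efE tauE opprB addrA addrAC subrr add0r subrr.
  rewrite scale0r sub0r oppr_eq0 => /eqP z0.
  have /eqP : x - tau *: x0 - t *: xi = 0.
    by apply: (spd_eq0 sA); rewrite tauE z0 dot0r.
  by rewrite -addrA -opprD subr_eq0 tauE => /eqP.
- by rewrite /t divfK // dotZl dur.
have fe : f = - e by apply/eqP; rewrite -addr_eq0 addrC ef.
have er0 : dot e r0 = 0 by rewrite /r0 dotBr eb eAS // subr0.
(* The two residuals differ by an element of [A S], which is orthogonal to [ri]. *)
have rr : dot r0 ri = dot ri ri.
  have -> : r0 = ri + A *m (xi - x0).
    by rewrite mulmxBr /r0 /ri addrA subrK.
  by rewrite dotDl xiP ?addr0 // memvB.
(* Used with [a = e], [c = r0], [d = ri]: the product of [w *: u] and [A *m u]. *)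
have crossE (a c d : 'cV[R]_n) : dot a c = 0 -> dot a d = 0 ->
    dot c d = dot d d -> dot (t *: d + a) ((1 - t) *: c - a) =
    t * (1 - t) * dot d d - dot a a.
  rewrite (dotC c d) => ac ad cd.
  by rewrite !(dotDl, dotBr, dotZl, dotZr) (dotC d a) ac ad cd; ring.
have AuE : A *m u = (1 - t) *: r0 - e by rewrite -fe -tauE addrC subrK.
have wuE : w *: u = t *: ri + e by rewrite addrC subrK.
by rewrite -dotZl AuE wuE crossE // gerBl dot_ge0.
Qed.

Lemma affine_hull_line (R : realType) (V : lmodType R) (X : set V) (p v : V)
    (q : R) : X p -> X (p + q *: v) -> q != 0 ->
  (forall y, X y -> exists t, y = p + t *: v) ->
  affine_hull X = [set p + t *: v | t in setT].
Proof.
move=> Xp Xq q0 Xv; apply/seteqP; split=> [_ [m [x [c [xX c1 ->]]]]|_ [s _ <-]].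
  have /boolp.choice[t xE] : forall i, exists t, x i = p + t *: v.
    by move=> i; apply: Xv.
  exists (\sum_i c i * t i) => //.
  rewrite scaler_suml -[X in X + _](scale1r p) -c1 scaler_suml -big_split /=.
  by apply: eq_bigr => i _; rewrite xE scalerDr scalerA.
(* The weights [1 - s / q] and [s / q] on the two known points of [X] reach [p + s *: v]. *)
exists 2, (fun i => if i == 0 then p else p + q *: v).
exists (fun i => if i == 0 then 1 - s / q else s / q); split.
- by move=> i; case: ifP.
- by rewrite big_ord_recl big_ord1 /= subrK.
rewrite big_ord_recl big_ord1 /= scalerDr scalerA divfK // addrA.
by rewrite -scalerDl subrK scale1r.
Qed.

Theorem theorem5p6 (R : realType) (n : nat) (A : 'M[R]_n) (b : 'cV[R]_n)
    (k : nat) (hA : spd A) (hk : (1 <= k)%N)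
    (hS : (1 <= \dim (krylov k A b))%N) :
  let S := krylov k A b in
  let X_b := affine_hull [set x_omega A b S w | w in [set w | omega_min A < w]] in
  (forall w : R, 0 < w ->
     convex_combination (x_omega A b S 0) (x_infty A b S) (x_omega A b S w)) /\
  (Ind A S = 1%N -> has_affine_dim X_b 1).
Proof.
move=> S X_b; rewrite {}/X_b; have n_gt0 : (0 < n)%N.
  have := leq_trans hS (dimvS (subvf _)).
  by rewrite dimvf dim_matrix muln_gt0 => /andP[].
have AT := spd_sym hA; have om0 := omega_min_lt0 n_gt0 hA.
have bS : b \in S by exact: memv_krylov_gen.
have decS y (yS : y \in S) := krylov_decomp yS.
have imgS y (yS : y \in S) := krylov_img yS.
(* The normal equations of the weighted problem, with [u] equal to [(A + w I)^-1] applied to the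
   residual. *)
have xwP w : omega_min A < w -> x_omega A b S w \in S /\ exists2 u,
    forall y, y \in S -> dot (A *m y) u = 0 &
    A *m u + w *: u = b - A *m x_omega A b S w.
  move=> hw; have MG := spd_mxpow_inv_sqrt (spd_shift n_gt0 hA hw).
  rewrite /x_omega; set G := mxpow _ _ in MG *.
  have -> : (fun x => norm2 (G *m (b - A *m x))) =
            (fun x => norm2 (G *m b - (G *m A) *m x)).
    by apply/funext => x; rewrite mulmxBr mulmxA.
  have [] := argmin_norm2P (G *m A) S (G *m b).
  set x := argmin _ _ => xS xP; split=> //.
  exists (G^T *m G *m (b - A *m x)) => [y yS|].
    by rewrite -mulmxA -{1}[G]trmxK -dot_mull trmxK mulmxA mulmxBr mulmxA xP.
  by rewrite -mul_scalar_mx -mulmxDl mulmxA MG mul1mx.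
have [xiS xiP] : x_infty A b S \in S /\ forall y, y \in S ->
  dot (A *m y) (b - A *m x_infty A b S) = 0 := argmin_norm2P A S b.
move: (x_omega A b S) (x_infty A b S) xwP xiS xiP.
move=> x xi xwP xiS xiP.
have [x0S [u0 u0P]] := xwP 0 om0; rewrite scale0r addr0 => u0E.
set x0 := x 0 in x0S u0E *.
(* For [w = 0] the residual is [A *m u0], and symmetry moves [A] onto [y]. *)
have x0P y : y \in S -> dot y (b - A *m x0) = 0.
  by move=> yS; rewrite -u0E -{1}AT -dot_mull u0P.
set ri := b - A *m xi.
have xwE w : omega_min A < w -> ri != 0 -> exists t,
    [/\ x w = (1 - t) *: x0 + t *: xi,
    0 < w -> b - A *m x w != 0 -> 0 < t &
    0 < w -> 0 <= t <= 1].
  move=> hw ri0; have [xS [u uP uE]] := xwP w hw.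
  have [t [xE tE tI]] := residual_interpolation hA bS decS imgS x0S x0P xiS xiP
    xS uP uE ri0.
  have rr := dot_gt0 ri0; have sAw := spd_shift n_gt0 hA hw.
  have AwE : A *m u + w *: u = (A + w%:M) *m u.
    by rewrite mulmxDl mul_scalar_mx.
  have AwE_ge0 : 0 <= dot u (A *m u + w *: u) by rewrite AwE spd_ge0.
  exists t; split=> // w0.
    move=> r0; rewrite -(pmulr_lgt0 _ rr) tE mulr_gt0 // AwE spd_gt0 //.
    by apply: contra_neq r0 => u00; rewrite -uE u00 mulmx0 scaler0 addr0.
  have t0 : 0 <= t by rewrite -(pmulr_lge0 _ rr) tE mulr_ge0 // ltW.
  (* For [t > 0] the sign of [t * (1 - t)] yields [t <= 1]; the case [t = 0] is immediate. *)
  rewrite t0 /=; have : 0 <= t * (1 - t).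
    rewrite -(pmulr_lge0 _ rr); apply: le_trans tI.
    exact: mulr_ge0 (ltW w0) (spd_ge0 _ hA).
  move: t0; rewrite le_eqVlt => /predU1P[<- _|t0]; first exact: ler01.
  by rewrite pmulr_rge0 // subr_ge0.
split=> [w w0|ind1].
  have hw := lt_trans om0 w0.
  (* If [ri = 0] then [b] lies in [A S], and [x w] is shown to equal [xi], so weight 0 on [x0]
     works. *)
  have [ri0|ri0] := eqVneq ri 0; last first.
    have [t [-> _ /(_ w0)/andP[t0 t1]]] := xwE w hw ri0.
    exists (1 - t); last by rewrite subKr.
    by rewrite subr_ge0 t1 gerBl.
  have bE : b = A *m xi by apply/eqP; rewrite -subr_eq0 -/ri ri0.
  have [xS [u uP uE]] := xwP w hw.
  exists 0; first by rewrite lexx ler01.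
  rewrite scale0r add0r subr0 scale1r; apply/esym/eqP; rewrite -subr_eq0.
  have AwE : A *m u + w *: u = (A + w%:M) *m u.
    by rewrite mulmxDl mul_scalar_mx.
  have rE : b - A *m x w = A *m (xi - x w).
    by rewrite mulmxBr -bE.
  have u00 : u = 0.
    apply: (spd_eq0 (spd_shift n_gt0 hA hw)).
    by rewrite -AwE uE rE dotC uP // memvB.
  apply/eqP/(spd_eq0 hA).
  by rewrite -rE -uE u00 mulmx0 scaler0 addr0 dot0r.
(* If [b = A *m xi], then [S] lies in [A S], whose dimension is at most that of [S], so the index
   would be 0. *)
have ri0 : ri != 0.
  apply/eqP => ri0; have bE : b = A *m xi.
    by apply/eqP; rewrite -subr_eq0 -/ri ri0.
  have SAS : (S <= linfun (mulmx A) @: S)%VS.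
    apply/subvP => y /decS[c [z [zS ->]]]; rewrite bE scalemxAr -mulmxDr.
    by rewrite -[_ *m _]/(mulmx A _) -lfunE memv_img // memvD // memvZ.
  have : (\dim (linfun (mulmx A) @: S) <= \dim S)%N.
    by rewrite -(limg_ker_dim (linfun (mulmx A)) S) leq_addl.
  rewrite -subn_eq0 => /eqP dimE; move: ind1.
  by rewrite /Ind (addv_idPr SAS) dimE.
(* If [xi = x0], then [ri] is orthogonal to both [b] and [A S], hence to itself. *)
have v0 : xi - x0 != 0.
  apply: contra_neq ri0 => /eqP; rewrite subr_eq0 => /eqP xx.
  apply/eqP; rewrite -dot_eq0 {1}/ri dotBl xiP // subr0.
  by rewrite /ri xx x0P.
have om1 : omega_min A < 1 := lt_trans om0 ltr01.
have line t : (1 - t) *: x0 + t *: xi = x0 + t *: (xi - x0).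
  by apply/colP=> i; rewrite !mxE; ring.
(* Any positive [w] would do: a positive parameter gives a second point besides [x0]. *)
have [t1 [x1E t1_gt0 _]] := xwE 1 om1 ri0.
exists x0, <[xi - x0]>%VS; split; last by rewrite dim_vline v0.
rewrite (@affine_hull_line _ _ _ x0 (xi - x0) t1).
- apply/seteqP; split=> [_ [t _ <-]|_ [_ /vlineP[c ->] <-]]; last by exists c.
  by exists (t *: (xi - x0)); rewrite //= memvZ // memv_line.
- by exists 0.
- by exists 1; rewrite // x1E line.
- rewrite gt_eqF // t1_gt0 //.
  have [x1S _] := xwP 1 om1.
  apply: contra_neq ri0 => /eqP; rewrite subr_eq0 => /eqP.
  exact: residual_eq0_of_mem_img xiS xiP x1S.
by move=> _ [w hw <-]; have [t [-> _ _]] := xwE w hw ri0; exists t; rewrite line.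
Qed.
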